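(* For any IMV-terms $\theta_1,\dots,\theta_m,\psi$ in the variables $X_1,\dots,X_n$, the following are equivalent: (i) $\theta_1,\dots,\theta_m\vdash_{\mathrm{IMV}}\psi$; (ii) for some integer $k>0$, the term $\neg\Phi\oplus\dots\oplus\neg\Phi\oplus\Delta\psi$ (with $k$ summands $\neg\Phi$), where $\Phi=\Delta\theta_1\odot\dots\odot\Delta\theta_m$, is a tautology; (iii) for some integer $k>0$, the term $(\Phi\odot\dots\odot\Phi)\to\Delta\psi$ (with $k$ factors $\Phi$) is a tautology, where $u\to v=\neg u\oplus v$; (iv) $\Delta\psi$ is obtainable via Modus Ponens from $\Delta\theta_1\odot\dots\odot\Delta\theta_m$ and the tautologies.
   Context: IMV-terms are terms over variables built from constants $0,1,\iota$, unary $\neg,\Delta,\nabla$ and binary $\oplus,\odot$; $\mathsf{FORM}(X_1,\dots,X_n)$ is the absolutely free algebra of IMV-terms in $X_1,\dots,X_n$. $\mathcal I([0,1])$ is the algebra of closed intervals $[a,b]\subseteq[0,1]$ ($a\le b$) of the standard MV-algebra $[0,1]$ ($\neg a=1-a$, $a\oplus b=\min(1,a+b)$, $a\odot b=\max(0,a+b-1)$), with constants $0=[0,0]$, $1=[1,1]$, $\iota=[0,1]$, operations $\neg x=\{\neg\alpha\mid\alpha\in x\}$, $x\oplus y=\{\alpha\oplus\beta\mid\alpha\in x,\beta\in y\}$, $x\odot y=\{\alpha\odot\beta\mid\alpha\in x,\beta\in y\}$ (intervals again), $\Delta[a,b]=[a,a]$, $\nabla[a,b]=[b,b]$. An IMV-term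 $\sigma$ is a tautology if the equation $\sigma=1$ holds in $\mathcal I([0,1])$ (equivalently, in all IMV-algebras). Consequence: $\theta_1,\dots,\theta_m\vdash_{\mathrm{IMV}}\psi$ means every homomorphism $\eta\colon\mathsf{FORM}(X_1,\dots,X_n)\to\mathcal I([0,1])$ with $\eta(\theta_i)=1$ for all $i$ satisfies $\eta(\psi)=1$. Modus Ponens is the rule deriving $\chi$ from $\varphi$ and $\varphi\to\chi$, where $u\to v=\neg u\oplus v$. *)

(* Defs.v *)
From mathcomp Require Import all_boot all_order all_algebra.
From mathcomp Require Import all_classical all_reals.
From mathcomp Require Import lra.

Set Implicit Arguments.
Unset Strict Implicit.
Unset Printing Implicit Defensive.

Import Order.TTheory GRing.Theory Num.Theory.
Local Open Scope classical_set_scope.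
Local Open Scope ring_scope.

Inductive FORM (n : nat) : Type :=
| TVar of 'I_n
| TZero
| TOne
| TIota
| TNeg of FORM n
| TDelta of FORM n
| TNabla of FORM n
| TAdd of FORM n & FORM n
| TMul of FORM n & FORM n.

Arguments TZero {n}.
Arguments TOne {n}.
Arguments TIota {n}.

Definition TImp (n : nat) (u v : FORM n) : FORM n := TAdd (TNeg u) v.

(* [chain op e [:: x1; ...; xk]] is x1 op x2 op ... op xk, bracketed to the
   left; the default e occurs only for the empty sequence. *)
Definition chain (T : Type) (op : T -> T -> T) (e : T) (s : seq T) : T :=
  if s is x :: s' then foldl op x s' else e.

(* The operations of the standard MV-algebra, extended to R by the same
   formulas; only their values on [0, 1] matter. *)
Section StandardMV.
Variable R : realType.
Implicit Types a b : R.

Definition mv_neg a : R := 1 - a.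
Definition mv_add a b : R := Num.min 1 (a + b).
Definition mv_mul a b : R := Num.max 0 (a + b - 1).

End StandardMV.

Section Intervals.
Variable R : realType.

Definition is_itv01 (A : set R) : Prop :=
  exists a b : R, [/\ 0 <= a, a <= b, b <= 1 & A = `[a, b]%classic].

Record itv01 : Type := Itv01 { pts :> set R; ptsP : is_itv01 pts }.

Implicit Types x y : itv01.

Lemma pts_inj : injective pts.
Proof.
by move=> [A hA] [B hB] /= AB; subst B; congr Itv01; exact: Prop_irrelevance.
Qed.

Lemma image_mv_neg (a b : R) :
  [set mv_neg t | t in `[a, b]%classic] = `[mv_neg b, mv_neg a]%classic.
Proof.
rewrite /mv_neg; apply/seteqP; split => [_ [t /= + <-]|g /=].
  by rewrite !in_itv /= => /andP[h1 h2]; apply/andP; split; lra.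
rewrite in_itv /= => /andP[h1 h2].
by exists (1 - g); [rewrite /= in_itv /=; apply/andP; split; lra|lra].
Qed.

Lemma image_mv_add (a b c d : R) : a <= b -> c <= d ->
  [set mv_add s t | s in `[a, b]%classic & t in `[c, d]%classic]
  = `[mv_add a c, mv_add b d]%classic.
Proof.
rewrite /mv_add => ab cd.
apply/seteqP; split => [_ [s /= + [t /= + <-]]|g /=].
  rewrite !in_itv /= => /andP[as_ sb] /andP[ct td].
  apply/andP; split; case: (leP 1 (s + t)) => h1.
  - by rewrite ge_min lexx.
  - by rewrite ge_min; apply/orP; right; lra.
  - by rewrite le_min lexx /=; lra.
  - by rewrite le_min; apply/andP; split; lra.
rewrite in_itv /= ge_min le_min => /andP[/orP ag /andP[g1 gbd]].
have [gE|gN] := eqVneq g 1.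
  exists b; first by rewrite /= in_itv /= ab lexx.
  exists d; first by rewrite /= in_itv /= cd lexx.
  by rewrite gE; apply/min_idPl; lra.
have {gN}gl : g < 1 by rewrite lt_neqAle gN g1.
have {ag}acg : a + c <= g by case: ag => ?; lra.
case: (leP b (g - c)) => h.
  exists b; first by rewrite /= in_itv /= ab lexx.
  exists (g - b); first by rewrite /= in_itv /=; apply/andP; split; lra.
  by rewrite (_ : b + (g - b) = g); [apply/min_idPr|lra].
exists (g - c); first by rewrite /= in_itv /=; apply/andP; split; lra.
exists c; first by rewrite /= in_itv /= cd lexx.
by rewrite (_ : g - c + c = g); [apply/min_idPr|lra].
Qed.

Lemma image_mv_mul (a b c d : R) : a <= b -> c <= d ->
  [set mv_mul s t | s in `[a, b]%classic & t in `[c, d]%classic]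
  = `[mv_mul a c, mv_mul b d]%classic.
Proof.
rewrite /mv_mul => ab cd.
apply/seteqP; split => [_ [s /= + [t /= + <-]]|g /=].
  rewrite !in_itv /= => /andP[as_ sb] /andP[ct td].
  apply/andP; split; case: (leP 0 (s + t - 1)) => h1.
  - by rewrite ge_max; apply/andP; split; lra.
  - by rewrite ge_max lexx /=; lra.
  - by rewrite le_max; apply/orP; right; lra.
  - by rewrite le_max lexx.
rewrite in_itv /= ge_max le_max => /andP[/andP[g0 acg] /orP gbd].
have [gE|gN] := eqVneq g 0.
  exists a; first by rewrite /= in_itv /= ab lexx.
  exists c; first by rewrite /= in_itv /= cd lexx.
  by rewrite gE; apply/max_idPl; lra.
have {gN}gl : 0 < g by rewrite lt_neqAle eq_sym gN g0.
have {}gbd : g <= b + d - 1 by case: gbd => ?; lra.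
case: (leP b (g + 1 - c)) => h.
  exists b; first by rewrite /= in_itv /= ab lexx.
  exists (g + 1 - b); first by rewrite /= in_itv /=; apply/andP; split; lra.
  by rewrite (_ : b + (g + 1 - b) - 1 = g); [apply/max_idPr|lra].
exists (g + 1 - c); first by rewrite /= in_itv /=; apply/andP; split; lra.
exists c; first by rewrite /= in_itv /= cd lexx.
by rewrite (_ : g + 1 - c + c - 1 = g); [apply/max_idPr|lra].
Qed.

Lemma inf_seg (a b : R) : a <= b -> inf `[a, b]%classic = a.
Proof.
move=> ab; apply/eqP; rewrite eq_le; apply/andP; split.
  apply: ge_inf; last by rewrite /= in_itv /= lexx.
  by exists a => t /=; rewrite in_itv /= => /andP[].
apply: lb_le_inf; first by exists a; rewrite /= in_itv /= lexx.
by move=> t /=; rewrite in_itv /= => /andP[].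
Qed.

Lemma sup_seg (a b : R) : a <= b -> sup `[a, b]%classic = b.
Proof.
move=> ab; apply/eqP; rewrite eq_le; apply/andP; split.
  apply: ge_sup; first by exists a; rewrite /= in_itv /= lexx.
  by move=> t /=; rewrite in_itv /= => /andP[].
apply: ub_le_sup; last by rewrite /= in_itv /= lexx andbT.
by exists b => t /=; rewrite in_itv /= => /andP[].
Qed.

Lemma seg_is_itv01 (a b : R) : 0 <= a -> a <= b -> b <= 1 ->
  is_itv01 `[a, b]%classic.
Proof. by move=> a0 ab b1; exists a, b. Qed.

Lemma neg_is_itv01 x : is_itv01 [set mv_neg t | t in x].
Proof.
case: (ptsP x) => a [b [a0 ab b1 ->]]; rewrite image_mv_neg.
by apply: seg_is_itv01; rewrite /mv_neg; lra.
Qed.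

Lemma add_is_itv01 x y : is_itv01 [set mv_add s t | s in x & t in y].
Proof.
case: (ptsP x) => a [b [a0 ab b1 ->]]; case: (ptsP y) => c [d [c0 cd d1 ->]].
rewrite image_mv_add // /mv_add; apply: seg_is_itv01.
- by rewrite le_min ler01 /=; lra.
- by case: (leP 1 (a + c)); case: (leP 1 (b + d)); lra.
- by rewrite ge_min lexx.
Qed.

Lemma mul_is_itv01 x y : is_itv01 [set mv_mul s t | s in x & t in y].
Proof.
case: (ptsP x) => a [b [a0 ab b1 ->]]; case: (ptsP y) => c [d [c0 cd d1 ->]].
rewrite image_mv_mul // /mv_mul; apply: seg_is_itv01.
- by rewrite le_max lexx.
- by case: (leP 0 (a + c - 1)); case: (leP 0 (b + d - 1)); lra.
- by rewrite ge_max ler01 /=; lra.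
Qed.

Lemma Delta_is_itv01 x : is_itv01 `[inf x, inf x]%classic.
Proof.
case: (ptsP x) => a [b [a0 ab b1 ->]]; rewrite inf_seg //.
by apply: seg_is_itv01 => //; lra.
Qed.

Lemma Nabla_is_itv01 x : is_itv01 `[sup x, sup x]%classic.
Proof.
case: (ptsP x) => a [b [a0 ab b1 ->]]; rewrite sup_seg //.
by apply: seg_is_itv01 => //; lra.
Qed.

(* IDeltaE and INablaE below: [inf, inf] and [sup, sup] are [a, a] and [b, b]
   when x = [a, b]. *)
Definition IZero : itv01 := Itv01 (seg_is_itv01 (lexx 0) (lexx 0) ler01).
Definition IOne : itv01 := Itv01 (seg_is_itv01 ler01 (lexx 1) (lexx 1)).
Definition IIota : itv01 := Itv01 (seg_is_itv01 (lexx 0) ler01 (lexx 1)).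
Definition INeg x : itv01 := Itv01 (neg_is_itv01 x).
Definition IDelta x : itv01 := Itv01 (Delta_is_itv01 x).
Definition INabla x : itv01 := Itv01 (Nabla_is_itv01 x).
Definition IAdd x y : itv01 := Itv01 (add_is_itv01 x y).
Definition IMul x y : itv01 := Itv01 (mul_is_itv01 x y).

Lemma IDeltaE x (a b : R) : a <= b -> pts x = `[a, b]%classic ->
  pts (IDelta x) = `[a, a]%classic.
Proof. by move=> ab /= ->; rewrite inf_seg. Qed.

Lemma INablaE x (a b : R) : a <= b -> pts x = `[a, b]%classic ->
  pts (INabla x) = `[b, b]%classic.
Proof. by move=> ab /= ->; rewrite sup_seg. Qed.

End Intervals.

Section Logic.
Variables (R : realType) (n : nat).
Implicit Types (s t : FORM n) (v : 'I_n -> itv01 R).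

Record is_hom (eta : FORM n -> itv01 R) : Prop := IsHom {
  hom_zero : eta TZero = IZero R;
  hom_one : eta TOne = IOne R;
  hom_iota : eta TIota = IIota R;
  hom_neg : forall s, eta (TNeg s) = INeg (eta s);
  hom_Delta : forall s, eta (TDelta s) = IDelta (eta s);
  hom_Nabla : forall s, eta (TNabla s) = INabla (eta s);
  hom_add : forall s t, eta (TAdd s t) = IAdd (eta s) (eta t);
  hom_mul : forall s t, eta (TMul s t) = IMul (eta s) (eta t)
}.

Fixpoint eval v t : itv01 R :=
  match t with
  | TVar i => v i
  | TZero => IZero R
  | TOne => IOne R
  | TIota => IIota R
  | TNeg s => INeg (eval v s)
  | TDelta s => IDelta (eval v s)
  | TNabla s => INabla (eval v s)
  | TAdd s1 s2 => IAdd (eval v s1) (eval v s2)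
  | TMul s1 s2 => IMul (eval v s1) (eval v s2)
  end.

Lemma eval_is_hom v : is_hom (eval v).
Proof. by split. Qed.

Lemma is_hom_eval eta : is_hom eta -> eta =1 eval (fun i => eta (TVar i)).
Proof.
case=> h0 h1 hi hn hD hN ha hm; elim=> //=.
- by move=> s IH; rewrite hn IH.
- by move=> s IH; rewrite hD IH.
- by move=> s IH; rewrite hN IH.
- by move=> s IHs t IHt; rewrite ha IHs IHt.
- by move=> s IHs t IHt; rewrite hm IHs IHt.
Qed.

Definition tautology t : Prop := forall v, eval v t = IOne R.

Definition consequence (m : nat) (theta : 'I_m -> FORM n) (psi : FORM n) : Prop :=
  forall eta, is_hom eta -> (forall i, eta (theta i) = IOne R) ->
    eta psi = IOne R.

Inductive MP_obtainable (A : FORM n -> Prop) : FORM n -> Prop :=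
| MP_premise s : A s -> MP_obtainable A s
| MP_step s t :
    MP_obtainable A s -> MP_obtainable A (TImp s t) -> MP_obtainable A t.

End Logic.

(* For m = 0 the empty product is read as the constant 1. *)
Definition Phi (n m : nat) (theta : 'I_m -> FORM n) : FORM n :=
  chain (@TMul n) TOne [seq TDelta (theta i) | i <- enum 'I_m].

(* Main.v *)
(** Interval endpoints of the value of a term are piecewise affine functions of
    the endpoints of the values of the variables.  Let p and q be 1 minus the
    lower endpoint of Phi and of psi.  Each of (ii) and (iii) says that
    q <= k * p everywhere, while (i) says that q vanishes wherever p does.  On
    each of the finitely many polyhedral pieces, infeasibility of the linear
    system p <= 0 < q has a Farkas certificate (obtained by Fourier-Motzkin
    elimination), which, q being bounded by 1, gives the constant k.  For (iv),
    the k-fold nested implication Phi -> ... -> Phi -> Delta psi is then a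
    tautology, and k uses of Modus Ponens discharge its premises. *)
Require Import Defs.
From mathcomp Require Import all_boot all_order all_algebra.
From mathcomp Require Import all_classical all_reals.
From mathcomp Require Import ring lra.

Set Implicit Arguments.
Unset Strict Implicit.
Unset Printing Implicit Defensive.

Import Order.TTheory GRing.Theory Num.Theory.
Local Open Scope ring_scope.

(* Shadowed by a number-notation constructor of constructive_ereal. *)
Local Notation IOne := Defs.IOne.

(** * Affine forms and Fourier-Motzkin elimination *)

Section AffineForms.
Variable R : realType.
Implicit Types (f g : nat -> R) (x : nat -> R) (c : (nat -> R) * bool).

(* Index 0 of f is the constant term, index i.+1 the coefficient of x i. *)
Definition aff (N : nat) f x : R := f 0%N + \sum_(i < N) f i.+1 * x i.

Definition lincomb (a : R) f (b : R) g : nat -> R := fun i => a * f i + b * g i.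

Lemma affS N f x : aff N.+1 f x = aff N f x + f N.+1 * x N.
Proof. by rewrite /aff big_ord_recr /= addrA. Qed.

Lemma eq_aff N f x y : (forall i, (i < N)%N -> x i = y i) ->
  aff N f x = aff N f y.
Proof. by move=> xy; congr (_ + _); apply: eq_bigr => i _; rewrite xy. Qed.

Lemma aff_lincomb N a f b g x :
  aff N (lincomb a f b g) x = a * aff N f x + b * aff N g x.
Proof.
elim: N => [|N IH]; first by rewrite /aff !big_ord0 !addr0.
by rewrite !affS IH /lincomb; ring.
Qed.

Lemma aff_cst N (r : R) x : aff N (fun i => if i is 0%N then r else 0) x = r.
Proof. by rewrite /aff big1 ?addr0 // => i _; rewrite mul0r. Qed.

Lemma aff_var N (k : nat) x : (k < N)%N ->
  aff N (fun i => (i == k.+1)%:R) x = x k.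
Proof.
move=> kN; rewrite /aff add0r (bigD1 (Ordinal kN)) //= eqxx mul1r.
by rewrite big1 ?addr0 // => i ik; rewrite eqSS (_ : (_ == _) = false) ?mul0r //;
   apply/negbTE.
Qed.

Definition sat N x c : bool :=
  if c.2 then 0 < aff N c.1 x else 0 <= aff N c.1 x.

Lemma seq_upper_bound (T : eqType) (F : T -> R) (s : seq T) : s != [::] ->
  exists2 a, a \in s & forall b, b \in s -> F b <= F a.
Proof.
elim: s => // a s IH _; case: s IH => [_|b s IH].
  by exists a; rewrite ?mem_head // => b; rewrite inE => /eqP ->.
have [//|d ds dmax] := IH; case: (leP (F a) (F d)) => [ad|/ltW da].
  exists d; first by rewrite inE ds orbT.
  by move=> e; rewrite inE => /predU1P[->|/dmax].
exists a; first exact: mem_head.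
by move=> e; rewrite inE => /predU1P[->//|/dmax h]; apply: le_trans da.
Qed.

(** The midpoint of the largest lower and the smallest upper bound works, or a point beyond the
    extreme bound if one list is empty. This supplies the value of an eliminated variable. *)
Lemma separating_point (T : eqType) (F : T -> R) (S : T -> bool) (lo up : seq T) :
  (forall l u, l \in lo -> u \in up ->
     if S l || S u then F l < F u else F l <= F u) ->
  exists y : R,
    (forall l, l \in lo -> if S l then F l < y else F l <= y) /\
    (forall u, u \in up -> if S u then y < F u else y <= F u).
Proof.
move=> H; have [->|lo0] := eqVneq lo [::].
  have [->|up0] := eqVneq up [::]; first by exists 0.
  have [m _ mmin] := seq_upper_bound (fun u => - F u) up0.
  exists (F m - 1); split=> // u /mmin; rewrite lerN2 => h.
  by case: (S u); lra.
have [M Mlo Mmax] := seq_upper_bound F lo0.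
have [->|up0] := eqVneq up [::].
  by exists (F M + 1); split=> // l /Mmax h; case: (S l); lra.
have [m mup mmin] := seq_upper_bound (fun u => - F u) up0.
have Mm : F M <= F m by have := H _ _ Mlo mup; case: ifP => // _ /ltW.
exists ((F M + F m) / 2); split=> [l ll|u uu].
  have lM := Mmax _ ll; have := H _ _ ll mup.
  by case: (S l) => /=; case: (S m); lra.
have := mmin _ uu; rewrite lerN2 => mu; have := H _ _ Mlo uu.
by case: (S u) => /=; case: (S M) => /=; lra.
Qed.

(* Fourier-Motzkin elimination.  The invariant P stands for membership in the
   cone generated by L; the conclusion is then a Farkas certificate. *)
Lemma fourier_motzkin N (P : (nat -> R) * bool -> Prop)
    (L : seq ((nat -> R) * bool)) :
  (forall a c b d, 0 < a -> 0 < b -> P c -> P d ->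
     P (lincomb a c.1 b d.1, c.2 || d.2)) ->
  (forall c, c \in L -> P c) ->
  (forall x, exists2 c, c \in L & ~~ sat N x c) ->
  exists c, [/\ P c, if c.2 then c.1 0%N <= 0 else c.1 0%N < 0
    & forall x, aff N c.1 x = c.1 0%N].
Proof.
elim: N P L => [|N IH] P L Pcomb PL unsat.
  have [c cL] := unsat (fun=> 0); rewrite /sat => ns.
  have c0 x : aff 0 c.1 x = c.1 0%N by rewrite /aff big_ord0 addr0.
  exists c; split=> //; first exact: PL.
  by move: ns; rewrite c0; case: c.2; rewrite -?leNgt -?ltNge.
(* Constraints are sorted by the sign of the coefficient of the last variable; [elim c d] is a
   positive combination in which that coefficient cancels. *)
pose L0 := [seq c <- L | c.1 N.+1 == 0].
pose Lp := [seq c <- L | 0 < c.1 N.+1].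
pose Lm := [seq c <- L | c.1 N.+1 < 0].
pose elim c d := (lincomb (- d.1 N.+1) c.1 (c.1 N.+1) d.1, c.2 || d.2).
pose L' := L0 ++ [seq elim c d | c <- Lp, d <- Lm].
have L'0 c : c \in L' -> P c /\ c.1 N.+1 = 0.
  rewrite mem_cat => /orP[|/allpairsP[[d e] /=]].
    by rewrite mem_filter => /andP[/eqP ? /PL].
  rewrite !mem_filter => -[/andP[d0 dL] /andP[e0 eL] ->]; split.
    by apply: Pcomb => //; [rewrite oppr_gt0|exact: PL|exact: PL].
  by rewrite /elim /lincomb /=; ring.
(* A point satisfying all of [L'] would extend, by a value of the last variable, to a point
   satisfying [L]. *)
have unsat' x : exists2 c, c \in L' & ~~ sat N x c.
  apply/not_exists2P => satL'.
  have {}satL' c : c \in L' -> sat N x c.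
    by move=> cL; case: (satL' c) => // /negP; rewrite negbK.
  (* [F c] is the value of the last variable that makes [c] an equality: a lower bound for [c] in
     [Lp], an upper bound for [c] in [Lm]. *)
  pose F c := - aff N c.1 x / c.1 N.+1.
  have [y [ylo yup]] : exists y : R,
      (forall c, c \in Lp -> if c.2 then F c < y else F c <= y) /\
      (forall c, c \in Lm -> if c.2 then y < F c else y <= F c).
    apply: (separating_point (S := snd)) => c d cp dm.
    have : sat N x (elim c d).
      by apply: satL'; rewrite mem_cat; apply/orP; right; apply: allpairs_f.
    move: cp dm; rewrite !mem_filter => /andP[c0 _] /andP[d0 _].
    rewrite /sat /= aff_lincomb /F.
    have -> : - aff N d.1 x / d.1 N.+1 = aff N d.1 x / - d.1 N.+1.
      by rewrite invrN mulrN mulNr.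
    have d0' : 0 < - d.1 N.+1 by rewrite oppr_gt0.
    by case: ifP => _; rewrite ?(ltr_pdivrMr, ler_pdivrMr) // mulrAC
         ?(ltr_pdivlMr, ler_pdivlMr) //; lra.
  have [c cL] := unsat (fun i => if i == N then y else x i).
  apply/negP; rewrite negbK /sat affS eqxx.
  rewrite (@eq_aff N c.1 _ x); last by move=> i iN; rewrite ltn_eqF.
  case: (ltgtP (c.1 N.+1) 0) => c0.
  - have /yup : c \in Lm by rewrite mem_filter c0.
    by rewrite /F; case: c.2; rewrite ?ltr_ndivlMr ?ler_ndivlMr //; lra.
  - have /ylo : c \in Lp by rewrite mem_filter c0.
    by rewrite /F; case: c.2; rewrite ?ltr_pdivrMr ?ler_pdivrMr //; lra.
  - have /satL' : c \in L' by rewrite mem_cat mem_filter c0 eqxx cL.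
    by rewrite /sat c0 mul0r addr0.
(* Putting the vanishing of the last coefficient into the invariant keeps the certificate constant
   in [N.+1] variables. *)
have [|c [[Pc c0] cneg cst]] := IH (fun c => P c /\ c.1 N.+1 = 0) L' _ L'0 unsat'.
  move=> a c b d a0 b0 [Pc c0] [Pd d0]; split; first exact: Pcomb.
  by rewrite /lincomb /= c0 d0; ring.
by exists c; split=> // x; rewrite affS cst c0 mul0r addr0.
Qed.


(** * Piecewise affine functions and domination *)

Lemma seq_uniform_bound (T : eqType) (Q : T -> R -> Prop) (s : seq T) :
  (forall a r r', r <= r' -> Q a r -> Q a r') ->
  (forall a, a \in s -> exists r, Q a r) ->
  exists r, forall a, a \in s -> Q a r.
Proof.
move=> Qmono; elim: s => [_|a s IH Qs]; first by exists 0.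
have [r Qr] := Qs a (mem_head _ _).
have [|r' Qr'] := IH; first by move=> b bs; apply: Qs; rewrite inE bs orbT.
exists (Num.max r r') => b; rewrite inE => /predU1P[->|/Qr'].
  by apply: Qmono Qr; rewrite le_max lexx.
by apply: Qmono; rewrite le_max lexx orbT.
Qed.

Definition in_piece N (C : seq (nat -> R)) x : Prop :=
  forall f, f \in C -> 0 <= aff N f x.

Lemma in_piece_cat N (C D : seq (nat -> R)) x :
  in_piece N (C ++ D) x <-> in_piece N C x /\ in_piece N D x.
Proof.
split=> [CD|[hC hD] c]; last by rewrite mem_cat => /orP[/hC|/hD].
by split=> c h; apply: CD; rewrite mem_cat h ?orbT.
Qed.

Lemma in_piece1 N f x : in_piece N [:: f] x <-> 0 <= aff N f x.
Proof.
split=> [|h c]; first by apply; rewrite mem_head.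
by rewrite inE => /eqP ->.
Qed.

(** Pieces are closed polyhedra that may overlap or be empty, so a common refinement only
    concatenates lists of constraints. *)
Definition piecewise_affine N (F : (nat -> R) -> R) : Prop :=
  exists L : seq (seq (nat -> R) * (nat -> R)),
    (forall x, exists2 p, p \in L & in_piece N p.1 x) /\
    (forall x p, p \in L -> in_piece N p.1 x -> F x = aff N p.2 x).

Section Piecewise.
Variable N : nat.
Implicit Types F G : (nat -> R) -> R.

Lemma pa_aff f F : (forall x, F x = aff N f x) -> piecewise_affine N F.
Proof.
move=> Ff; exists [:: ([::], f)]; split=> [x|x p].
  by exists ([::], f); rewrite ?mem_head // => c; rewrite in_nil.
by rewrite inE => /eqP -> _; apply: Ff.
Qed.

Lemma pa_cst (r : R) : piecewise_affine N (fun=> r).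
Proof. exact: pa_aff (fun x => esym (aff_cst N r x)). Qed.

Lemma pa_var k : (k < N)%N -> piecewise_affine N (fun x => x k).
Proof. by move=> kN; exact: pa_aff (fun x => esym (aff_var x kN)). Qed.

Lemma pa_lincomb a F b G : piecewise_affine N F -> piecewise_affine N G ->
  piecewise_affine N (fun x => a * F x + b * G x).
Proof.
move=> [L [Lcov LF]] [M [Mcov MG]].
exists [seq (p.1 ++ q.1, lincomb a p.2 b q.2) | p <- L, q <- M]; split=> x.
  have [p pL px] := Lcov x; have [q qM qx] := Mcov x.
  exists (p.1 ++ q.1, lincomb a p.2 b q.2).
    by apply/allpairsP; exists (p, q).
  by apply/in_piece_cat.
move=> _ /allpairsP[[p q] /= [pL qM ->]] /= /in_piece_cat[px qx].
by rewrite aff_lincomb (LF x p) // (MG x q).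
Qed.

(** Each cell of the common refinement is cut in two by the sign of the difference of the two affine
    forms. *)
Lemma pa_max F G : piecewise_affine N F -> piecewise_affine N G ->
  piecewise_affine N (fun x => Num.max (F x) (G x)).
Proof.
move=> [L [Lcov LF]] [M [Mcov MG]].
pose dif f g := [:: lincomb 1 f (-1) g].
have difE f g x : in_piece N (dif f g) x <-> aff N g x <= aff N f x.
  by rewrite in_piece1 aff_lincomb mul1r mulN1r subr_ge0.
exists ([seq (p.1 ++ q.1 ++ dif p.2 q.2, p.2) | p <- L, q <- M] ++
        [seq (p.1 ++ q.1 ++ dif q.2 p.2, q.2) | p <- L, q <- M]); split=> x.
  have [p pL px] := Lcov x; have [q qM qx] := Mcov x.
  case: (leP (aff N q.2 x) (aff N p.2 x)) => [h|/ltW h].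
    exists (p.1 ++ q.1 ++ dif p.2 q.2, p.2).
      by rewrite mem_cat; apply/orP; left; apply/allpairsP; exists (p, q).
    by do 2![apply/in_piece_cat; split=> //]; apply/difE.
  exists (p.1 ++ q.1 ++ dif q.2 p.2, q.2).
    by rewrite mem_cat; apply/orP; right; apply/allpairsP; exists (p, q).
  by do 2![apply/in_piece_cat; split=> //]; apply/difE.
move=> r; rewrite mem_cat => /orP[] /allpairsP[[p q] /= [pL qM ->]] /=
  /in_piece_cat[px /in_piece_cat[qx /difE h]];
  rewrite (LF x p) // (MG x q) //; first exact: max_l.
exact: max_r.
Qed.

Lemma pa_ext F G : F =1 G -> piecewise_affine N F -> piecewise_affine N G.
Proof. by move=> /funext ->. Qed.

Lemma pa_add F G : piecewise_affine N F -> piecewise_affine N G ->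
  piecewise_affine N (fun x => F x + G x).
Proof.
by move=> pF pG; apply: (pa_ext _ (pa_lincomb 1 1 pF pG)) => x; rewrite !mul1r.
Qed.

Lemma pa_sub F G : piecewise_affine N F -> piecewise_affine N G ->
  piecewise_affine N (fun x => F x - G x).
Proof.
move=> pF pG; apply: (pa_ext _ (pa_lincomb 1 (-1) pF pG)) => x.
by rewrite mul1r mulN1r.
Qed.

Lemma pa_min F G : piecewise_affine N F -> piecewise_affine N G ->
  piecewise_affine N (fun x => Num.min (F x) (G x)).
Proof.
(* The minimum is the sum less the maximum. *)
move=> pF pG; apply: (pa_ext _ (pa_sub (pa_add pF pG) (pa_max pF pG))) => x.
by case: (leP (F x) (G x)) => _; ring.
Qed.

(* Infeasibility of "in C, f <= 0 and 0 < g" yields by Farkas multipliers mu, nu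
   with nu * g - mu * f <= r on C for a constant r <= 0. *)
Lemma piece_dominated (C : seq (nat -> R)) f g :
  (forall x, in_piece N C x -> 0 <= aff N f x) ->
  (forall x, in_piece N C x -> aff N g x <= 1) ->
  (forall x, in_piece N C x -> aff N f x <= 0 -> aff N g x <= 0) ->
  exists r : R, forall x, in_piece N C x -> aff N g x <= r * aff N f x.
Proof.
move=> f0 g1 fg.
(* The cone of consequences of the system on the piece, with its multipliers. A strict member has
   [0 < nu], as [g] is the only strict generator. *)
pose P (c : (nat -> R) * bool) := exists mu nu : R,
  [/\ 0 <= mu, 0 <= nu, c.2 -> 0 < nu
    & forall x, in_piece N C x -> nu * aff N g x - mu * aff N f x <= aff N c.1 x].
pose nf := lincomb (-1) f 0 f.
have nfE x : aff N nf x = - aff N f x by rewrite aff_lincomb; ring.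
pose L := (nf, false) :: (g, true) :: [seq (h, false) | h <- C].
have [||x|c [[mu [nu [mu0 nu0 cnu cP]]] cneg cst]] := @fourier_motzkin N P L.
- move=> a c b d a0 b0 [mu [nu [mu0 nu0 cnu cP]]] [mu' [nu' [mu0' nu0' dnu dP]]].
  exists (a * mu + b * mu'), (a * nu + b * nu'); split.
  + by rewrite addr_ge0 ?mulr_ge0 // ltW.
  + by rewrite addr_ge0 ?mulr_ge0 // ltW.
  + move=> /= /orP[/cnu h|/dnu h].
      by rewrite ltr_wpDr ?mulr_gt0 ?mulr_ge0 // ltW.
    by rewrite ltr_wpDl ?mulr_gt0 ?mulr_ge0 // ltW.
  + move=> x Cx /=; rewrite aff_lincomb.
    have /= := lerD (ler_wpM2l (ltW a0) (cP _ Cx)) (ler_wpM2l (ltW b0) (dP _ Cx)).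
    by apply: le_trans; rewrite le_eqVlt; apply/orP; left; apply/eqP; ring.
- move=> c; rewrite !inE => /or3P[/eqP ->|/eqP ->|/mapP[d dC ->]].
  + by exists 1, 0; split=> // x Cx /=; rewrite nfE; lra.
  + by exists 0, 1; split=> // x Cx /=; lra.
  + by exists 0, 0; split=> // x Cx /=; have := Cx d dC; lra.
- have [Cx|/existsNP[c /not_implyP[cC /negP cx]]] := pselect (in_piece N C x).
    have [h|h] := leP (aff N f x) 0.
      exists (g, true); rewrite ?inE ?eqxx ?orbT // /sat /= -leNgt.
      exact: fg.
    exists (nf, false); rewrite ?inE ?eqxx // /sat /= nfE -ltNge.
    by rewrite oppr_lt0.
  exists (c, false) => //; rewrite !inE; apply/or3P/Or33.
  by apply/mapP; exists c.
(* The constant of the certificate is at most 0, so for [0 < nu] the bound follows on dividing by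
   [nu]. *)
have [nup|nu0'] := ltP 0 nu.
  exists (mu / nu) => x Cx; rewrite mulrAC ler_pdivlMr //.
  by have := cP x Cx; rewrite cst; move: cneg; case: c.2; lra.
(* For [nu = 0] the certificate is not strict and its constant is negative: [mu] times the form [f]
   stays above a positive number, and scaling it to exceed 1 dominates [g]. *)
have {nu0'}nu0' : nu = 0 by lra.
have c2 : c.2 = false by apply/negP => /cnu; rewrite nu0' ltxx.
rewrite c2 in cneg; exists (mu / - c.1 0%N) => x Cx.
apply: le_trans (g1 x Cx) _; rewrite mulrAC ler_pdivlMr ?oppr_gt0 //.
by have := cP x Cx; rewrite cst nu0'; lra.
Qed.

(** Each pair of pieces has its own constant. As [F] is nonnegative, a common upper bound of these
    constants serves everywhere, and it may be rounded up to a positive integer. *)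
Lemma pa_dominated F G : piecewise_affine N F -> piecewise_affine N G ->
  (forall x, 0 <= F x) -> (forall x, G x <= 1) ->
  (forall x, F x <= 0 -> G x <= 0) ->
  exists2 k : nat, (0 < k)%N & forall x, G x <= k%:R * F x.
Proof.
move=> [L [Lcov LF]] [M [Mcov MG]] F0 G1 FG.
pose Q (pq : (seq (nat -> R) * (nat -> R)) * (seq (nat -> R) * (nat -> R))) r :=
  forall x, in_piece N pq.1.1 x -> in_piece N pq.2.1 x -> G x <= r * F x.
have [||r Qr] := @seq_uniform_bound _ Q [seq (p, q) | p <- L, q <- M].
- move=> pq r r' rr' h x px qx; apply: le_trans (h x px qx) _.
  exact: ler_wpM2r.
- move=> _ /allpairsP[[p q] /= [pL qM ->]].
  have [x|x|x|r h] := @piece_dominated (p.1 ++ q.1) p.2 q.2.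
  + by move=> /in_piece_cat[px qx]; rewrite -(LF x p).
  + by move=> /in_piece_cat[px qx]; rewrite -(MG x q).
  + by move=> /in_piece_cat[px qx]; rewrite -(LF x p) // -(MG x q) //; apply: FG.
  + exists r => x /= px qx; rewrite (LF x p) // (MG x q) //.
    by apply: h; apply/in_piece_cat.
exists (Num.truncn r).+1 => // x.
have [p pL px] := Lcov x; have [q qM qx] := Mcov x.
apply: le_trans (Qr (p, q) _ x px qx) _; first by apply/allpairsP; exists (p, q).
by apply: ler_wpM2r => //; apply/ltW/truncnS_gt.
Qed.

End Piecewise.
End AffineForms.

(** * Endpoints of intervals *)

Section Endpoints.
Variable R : realType.
Implicit Types x y : itv01 R.

Definition lo x : R := inf (pts x).
Definition up x : R := sup (pts x).

Lemma endpoints x (a b : R) : a <= b -> pts x = `[a, b]%classic ->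
  lo x = a /\ up x = b.
Proof. by rewrite /lo /up => ab ->; rewrite inf_seg // sup_seg. Qed.

Lemma itv01P x : [/\ 0 <= lo x, lo x <= up x, up x <= 1
  & pts x = `[lo x, up x]%classic].
Proof.
case: (ptsP x) => a [b [a0 ab b1 xE]].
by have [-> ->] := endpoints ab xE; split.
Qed.

Lemma itv01_eq x y : lo x = lo y -> up x = up y -> x = y.
Proof.
move=> hl hu; apply: pts_inj.
by have [_ _ _ ->] := itv01P x; have [_ _ _ ->] := itv01P y; rewrite hl hu.
Qed.

Lemma endpoints_IOne : lo (IOne R) = 1 /\ up (IOne R) = 1.
Proof. exact: endpoints. Qed.

Lemma endpoints_INeg x : lo (INeg x) = 1 - up x /\ up (INeg x) = 1 - lo x.
Proof.
have [_ ab _ xE] := itv01P x.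
by apply: endpoints; [lra|rewrite /= xE image_mv_neg].
Qed.

Lemma endpoints_IDelta x : lo (IDelta x) = lo x /\ up (IDelta x) = lo x.
Proof. exact: endpoints. Qed.

Lemma endpoints_INabla x : lo (INabla x) = up x /\ up (INabla x) = up x.
Proof. exact: endpoints. Qed.

Lemma endpoints_IAdd x y : lo (IAdd x y) = mv_add (lo x) (lo y) /\
  up (IAdd x y) = mv_add (up x) (up y).
Proof.
have [_ ab _ xE] := itv01P x; have [_ cd _ yE] := itv01P y.
apply: endpoints; last by rewrite /= xE yE image_mv_add.
by rewrite /mv_add; apply: le_min2 => //; lra.
Qed.

Lemma endpoints_IMul x y : lo (IMul x y) = mv_mul (lo x) (lo y) /\
  up (IMul x y) = mv_mul (up x) (up y).
Proof.
have [_ ab _ xE] := itv01P x; have [_ cd _ yE] := itv01P y.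
apply: endpoints; last by rewrite /= xE yE image_mv_mul.
by rewrite /mv_mul; apply: le_max2 => //; lra.
Qed.

(** The upper endpoint is squeezed between the lower one and 1. Hence the truth of a term can be
    read off its lower endpoint. *)
Lemma IOneP x : x = IOne R <-> lo x = 1.
Proof.
have [l1 u1] := endpoints_IOne.
split=> [->//|x1]; apply: itv01_eq; first by rewrite x1.
by have [_ ? ? _] := itv01P x; rewrite u1; lra.
Qed.

Lemma IAdd_INeg_IOne x : IAdd (INeg (IOne R)) x = x.
Proof.
have [l1 u1] := endpoints_IOne.
have [ln un] := endpoints_INeg (IOne R).
have [la ua] := endpoints_IAdd (INeg (IOne R)) x.
have [x0 lx x1 _] := itv01P x.
by apply: itv01_eq; rewrite ?la ?ua ?ln ?un ?l1 ?u1 subrr /mv_add add0r;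
  apply: min_r; lra.
Qed.

Lemma seg_subproof (a b : R) : is_itv01
  `[Num.max 0 (Num.min 1 (Num.min a b)), Num.max 0 (Num.min 1 (Num.max a b))]%classic.
Proof.
apply: seg_is_itv01; first by rewrite le_max lexx.
- apply: le_max2 => //; apply: le_min2 => //.
  by rewrite ge_min !le_max lexx.
- by rewrite ge_max ler01 ge_min lexx.
Qed.

(* A total surjection of pairs of reals onto itv01 with piecewise affine endpoints. *)
Definition seg (a b : R) : itv01 R := Itv01 (seg_subproof a b).

Lemma endpoints_seg (a b : R) :
  lo (seg a b) = Num.max 0 (Num.min 1 (Num.min a b)) /\
  up (seg a b) = Num.max 0 (Num.min 1 (Num.max a b)).
Proof.
apply: endpoints => //; apply: le_max2 => //; apply: le_min2 => //.
by rewrite ge_min !le_max lexx.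
Qed.

Lemma segK x : seg (lo x) (up x) = x.
Proof.
have [x0 lx x1 _] := itv01P x; have [sl su] := endpoints_seg (lo x) (up x).
apply: itv01_eq; rewrite ?sl ?su.
- by rewrite (min_l lx) min_r ?max_r; lra.
- by rewrite (max_r lx) min_r ?max_r; lra.
Qed.

End Endpoints.

(** * Endpoints of the values of terms *)

Section Evaluation.
Variables (R : realType) (n : nat).
Implicit Types (s t : FORM n) (v : 'I_n -> itv01 R).

(** Valuations are parametrized by [n + n] unconstrained reals, two per variable, so that piecewise
    affine functions on the whole space apply. *)
Definition valuation (x : nat -> R) : 'I_n -> itv01 R :=
  fun i => seg (x i) (x (n + i)%N).

Lemma valuation_surj v : exists x, valuation x = v.
Proof.
(* Coordinates below [n] hold lower endpoints, the next [n] upper ones; the value 0 beyond them is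
   arbitrary. *)
exists (fun j => match insub j with
  | Some i => lo (v i)
  | None => if insub (j - n)%N is Some i then up (v i) else 0 end).
apply/funext => i; rewrite /valuation valK insubF ?addKn ?valK ?segK //.
by rewrite ltnNge leq_addr.
Qed.

(** Both endpoints go through the induction together, because negation exchanges them and [TNabla]
    turns the upper into a lower one. *)
Lemma pa_eval t :
  piecewise_affine (n + n) (fun x => lo (eval (valuation x) t)) /\
  piecewise_affine (n + n) (fun x => up (eval (valuation x) t)).
Proof.
have ext := fun F G h => @pa_ext R (n + n) G F (fun x => esym (h x)).
have pcst := pa_cst (n + n).
elim: t => [i||||s [IHl IHu]|s [IHl IHu]|s [IHl IHu]
  |s [sl su] t [tl tu]|s [sl su] t [tl tu]] /=; split.
- apply: ext (fun x => (endpoints_seg _ _).1) _.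
  have h1 : (i < n + n)%N by rewrite ltn_addr.
  have h2 : (n + i < n + n)%N by rewrite ltn_add2l.
  apply: pa_max => //; apply: pa_min => //.
  by apply: pa_min; apply: pa_var.
- apply: ext (fun x => (endpoints_seg _ _).2) _.
  have h1 : (i < n + n)%N by rewrite ltn_addr.
  have h2 : (n + i < n + n)%N by rewrite ltn_add2l.
  apply: pa_max => //; apply: pa_min => //.
  by apply: pa_max; apply: pa_var.
- exact: pcst.
- exact: pcst.
- exact: pcst.
- exact: pcst.
- exact: pcst.
- exact: pcst.
- by apply: ext (fun x => (endpoints_INeg _).1) _; apply: pa_sub.
- by apply: ext (fun x => (endpoints_INeg _).2) _; apply: pa_sub.
- by apply: ext (fun x => (endpoints_IDelta _).1) _.
- by apply: ext (fun x => (endpoints_IDelta _).2) _.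
- by apply: ext (fun x => (endpoints_INabla _).1) _.
- by apply: ext (fun x => (endpoints_INabla _).2) _.
- by apply: ext (fun x => (endpoints_IAdd _ _).1) _; apply: pa_min => //; apply: pa_add.
- by apply: ext (fun x => (endpoints_IAdd _ _).2) _; apply: pa_min => //; apply: pa_add.
- apply: ext (fun x => (endpoints_IMul _ _).1) _; apply: pa_max => //.
  by apply: pa_sub => //; apply: pa_add.
- apply: ext (fun x => (endpoints_IMul _ _).2) _; apply: pa_max => //.
  by apply: pa_sub => //; apply: pa_add.
Qed.

Lemma lo_eval_add v s t :
  lo (eval v (TAdd s t)) = mv_add (lo (eval v s)) (lo (eval v t)).
Proof. exact: (endpoints_IAdd _ _).1. Qed.

Lemma lo_eval_mul v s t :
  lo (eval v (TMul s t)) = mv_mul (lo (eval v s)) (lo (eval v t)).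
Proof. exact: (endpoints_IMul _ _).1. Qed.

Lemma lo_eval_Delta v s : lo (eval v (TDelta s)) = lo (eval v s).
Proof. exact: (endpoints_IDelta _).1. Qed.

(** The value is a single point. Only then is the lower endpoint of a negation determined by the
    lower endpoint of its argument; [TDelta] guarantees this for the factors of [Phi]. *)
Definition thin v t : Prop := up (eval v t) = lo (eval v t).

Lemma thin_Delta v t : thin v (TDelta t).
Proof. by rewrite /thin /= (endpoints_IDelta _).1 (endpoints_IDelta _).2. Qed.

Lemma thin_mul v s t : thin v s -> thin v t -> thin v (TMul s t).
Proof.
by rewrite /thin /= (endpoints_IMul _ _).1 (endpoints_IMul _ _).2 => -> ->.
Qed.

Lemma lo_eval_neg v t : thin v t -> lo (eval v (TNeg t)) = 1 - lo (eval v t).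
Proof. by rewrite /= (endpoints_INeg _).1 => ->. Qed.

Lemma lo_eval_bounds v t : 0 <= lo (eval v t) <= 1.
Proof.
by have [-> h1 h2 _] := itv01P (eval v t); rewrite (le_trans h1).
Qed.

Lemma chain_mul_thin v (L : seq (FORM n)) :
  (forall t, List.In t L -> thin v t) -> thin v (chain (@TMul n) TOne L).
Proof.
have h a (s : seq (FORM n)) : thin v a -> (forall t, List.In t s -> thin v t) ->
    thin v (foldl (@TMul n) a s).
  elim: s a => //= b s IH a ta ts; apply: IH => [|t ?]; last by apply: ts; right.
  by apply: thin_mul => //; apply: ts; left.
case: L => [|a s] ts /=.
  by rewrite /thin /= (endpoints_IOne R).1 (endpoints_IOne R).2.
by apply: h => [|t ?]; apply: ts; [left|right].
Qed.

(** A product of two numbers of the unit interval is 1 only if both are. *)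
Lemma chain_mul_eq1 v (L : seq (FORM n)) :
  lo (eval v (chain (@TMul n) TOne L)) = 1 <->
  (forall t, List.In t L -> lo (eval v t) = 1).
Proof.
have h a (s : seq (FORM n)) : lo (eval v (foldl (@TMul n) a s)) = 1 <->
    lo (eval v a) = 1 /\ (forall t, List.In t s -> lo (eval v t) = 1).
  elim: s a => [|b s IH] a /=; first by split=> [->|[]].
  have /andP[a0 a1] := lo_eval_bounds v a; have /andP[b0 b1] := lo_eval_bounds v b.
  rewrite IH lo_eval_mul /mv_mul; split=> [[m1 ts]|[a1' ts]].
    suff [ha hb] : lo (eval v a) = 1 /\ lo (eval v b) = 1.
      by split=> // t [<-|/ts].
    by move: m1; case: (leP 0 (lo (eval v a) + lo (eval v b) - 1)); lra.
  split=> [|t ?]; last by apply: ts; right.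
  by rewrite a1' (ts b) ?max_r //; [lra|lra|left].
case: L => [|a s] /=; first by split=> // _; rewrite (endpoints_IOne R).1.
rewrite h; split=> [[ha ts] t [<-//|/ts]//|ts].
by split=> [|t ?]; apply: ts; [left|right].
Qed.

(** The summands are nonnegative, so truncating at 1 after each step agrees with truncating once at
    the end. *)
Lemma chain_nseq_add v k s t : (0 < k)%N ->
  lo (eval v (chain (@TAdd n) TZero (rcons (nseq k s) t))) =
  mv_add (k%:R * lo (eval v s)) (lo (eval v t)).
Proof.
case: k => // k _; have /andP[s0 s1] := lo_eval_bounds v s.
have /andP[t0 t1] := lo_eval_bounds v t.
rewrite /= -cats1 foldl_cat /= lo_eval_add.
have -> : lo (eval v (foldl (@TAdd n) s (nseq k s))) =
    Num.min 1 (k.+1%:R * lo (eval v s)).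
  elim: k => [|k IH]; first by rewrite /= mul1r min_r.
  rewrite -[in LHS]addn1 nseqD foldl_cat /= lo_eval_add IH /mv_add.
  rewrite -(natr1 k.+1) mulrDl mul1r.
  set u := k.+1%:R * _; case: (leP 1 u) => hu //.
  by rewrite !min_l //; lra.
rewrite /mv_add; case: (leP 1 (k.+1%:R * lo (eval v s))) => // h.
by rewrite !min_l //; lra.
Qed.

(** Measured by the distance to 1, multiplication is truncated addition. *)
Lemma chain_nseq_mul v k s : (0 < k)%N ->
  lo (eval v (chain (@TMul n) TOne (nseq k s))) =
  Num.max 0 (1 - k%:R * (1 - lo (eval v s))).
Proof.
case: k => // k _; have /andP[s0 s1] := lo_eval_bounds v s.
elim: k => [|k IH]; first by rewrite /= mul1r max_r; lra.
rewrite -[in LHS]addn1 nseqD /= foldl_cat /= lo_eval_mul IH /mv_mul.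
rewrite -(natr1 k.+1) mulrDl mul1r.
set u := k.+1%:R * _; case: (leP 0 (1 - u)) => hu.
  by congr Num.max; lra.
by rewrite !max_l //; lra.
Qed.

(** Nesting implications adds the negated premise [k] times, giving the same lower endpoint as the
    sum in (ii). *)
Lemma iter_imp v k s t : thin v s ->
  lo (eval v (iter k (TImp s) t)) =
  mv_add (k%:R * (1 - lo (eval v s))) (lo (eval v t)).
Proof.
move=> ts; have /andP[s0 s1] := lo_eval_bounds v s.
have /andP[t0 t1] := lo_eval_bounds v t.
elim: k => [|k IH]; first by rewrite /= /mv_add mul0r add0r min_r.
rewrite iterS lo_eval_add lo_eval_neg // IH -natr1 mulrDl mul1r /mv_add.
set u := k%:R * _; case: (leP 1 (u + lo (eval v t))) => hu.
  by rewrite !min_l //; lra.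
by congr Num.min; lra.
Qed.

(** * Tautologies, Modus Ponens and consequence *)

Lemma tautologyP t : tautology R t <-> forall v, lo (eval v t) = 1.
Proof. by split=> h v; apply/IOneP/h. Qed.

Lemma mv_add_eq1 (a b : R) : mv_add a b = 1 <-> 1 - b <= a.
Proof. by rewrite /mv_add; case: (leP 1 (a + b)) => h; split=> // ?; lra. Qed.

Lemma MP_obtainable_sound v (A : FORM n -> Prop) :
  (forall s, A s -> eval v s = IOne R) ->
  forall s, MP_obtainable A s -> eval v s = IOne R.
Proof.
move=> Av s; elim=> {s} [s /Av//|s t _ s1 _ /=].
by rewrite s1 IAdd_INeg_IOne.
Qed.

Lemma MP_obtainable_iter_imp (A : FORM n -> Prop) k s t : A s ->
  MP_obtainable A (iter k (TImp s) t) -> MP_obtainable A t.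
Proof.
move=> As; elim: k => //= k IH h; apply: IH.
by apply: MP_step h; apply: MP_premise.
Qed.

Variables (m : nat) (theta : 'I_m -> FORM n).

Lemma In_Phi t : List.In t [seq TDelta (theta i) | i <- enum 'I_m] <->
  exists i, t = TDelta (theta i).
Proof.
rewrite List.in_map_iff; split=> [[i [<- _]]|[i ->]]; first by exists i.
exists i; split=> //; have := mem_enum 'I_m i; rewrite inE.
by elim: (enum 'I_m) => //= j s IH; rewrite inE => /predU1P[->|/IH]; [left|right].
Qed.

Lemma thin_Phi v : thin v (Phi theta).
Proof. by apply: chain_mul_thin => t /In_Phi[i ->]; apply: thin_Delta. Qed.

Lemma eval_Phi_eq1 v :
  lo (eval v (Phi theta)) = 1 <-> forall i, eval v (theta i) = IOne R.
Proof.
rewrite chain_mul_eq1; split=> [h i|h t /In_Phi[i ->]].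
  by apply/IOneP; rewrite -lo_eval_Delta; apply: h; apply/In_Phi; exists i.
by rewrite lo_eval_Delta; apply/IOneP.
Qed.

(** Homomorphisms are exactly the evaluations, and all premises have value 1 exactly when [Phi]
    does. *)
Lemma consequenceP psi : consequence R theta psi <->
  forall v, lo (eval v (Phi theta)) = 1 -> lo (eval v psi) = 1.
Proof.
split=> [h v /eval_Phi_eq1 th|h eta he th].
  by apply/IOneP; apply: (h (eval v) (eval_is_hom v)).
rewrite (is_hom_eval he); apply/IOneP/h/eval_Phi_eq1 => i.
by rewrite -(is_hom_eval he).
Qed.

(** Domination is applied to the distances to 1 of [Phi] and [psi], as functions of the real
    coordinates, and carried to all valuations by surjectivity. Conversely, the inequality forces
    the second distance to vanish with the first. *)
Lemma consequence_dominated psi : consequence R theta psi <->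
  exists k : nat, (0 < k)%N /\
    forall v, 1 - lo (eval v psi) <= k%:R * (1 - lo (eval v (Phi theta))).
Proof.
rewrite consequenceP; split=> [h|[k [_ h]] v v1]; last first.
  have := h v; rewrite v1 subrr mulr0.
  by have /andP[] := lo_eval_bounds v psi; lra.
have [||x|x|x|k k0 hk] := @pa_dominated R (n + n)
  (fun x => 1 - lo (eval (valuation x) (Phi theta)))
  (fun x => 1 - lo (eval (valuation x) psi)).
- by apply: pa_sub; [exact: pa_cst|exact: (pa_eval _).1].
- by apply: pa_sub; [exact: pa_cst|exact: (pa_eval _).1].
- by have /andP[] := lo_eval_bounds (valuation x) (Phi theta); lra.
- by have /andP[] := lo_eval_bounds (valuation x) psi; lra.
- have /andP[_ ?] := lo_eval_bounds (valuation x) (Phi theta).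
  by move=> ?; rewrite h; lra.
- by exists k; split=> // v; have [x <-] := valuation_surj v; apply: hk.
Qed.

End Evaluation.

Theorem theorem7p1 (R : realType) (n m : nat) (theta : 'I_m -> FORM n)
    (psi : FORM n) :
  [/\ consequence R theta psi <->
        (exists k : nat, (0 < k)%N /\
           tautology R (chain (@TAdd n) TZero
             (rcons (nseq k (TNeg (Phi theta))) (TDelta psi)))),
      consequence R theta psi <->
        (exists k : nat, (0 < k)%N /\
           tautology R (TImp (chain (@TMul n) TOne (nseq k (Phi theta)))
                             (TDelta psi)))
    & consequence R theta psi <->
        MP_obtainable (fun s : FORM n => s = Phi theta \/ tautology R s)
          (TDelta psi)].
Proof.
have tP (v : 'I_n -> itv01 R) := thin_Phi theta v.
(* The clause on Modus Ponens is treated first. *)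
split; first 2 last.
- split=> [/consequence_dominated[k [k0 h]]|h].
    apply: (@MP_obtainable_iter_imp _ _ k (Phi theta)); first by left.
    apply: MP_premise; right; apply/tautologyP => v.
    by rewrite iter_imp // lo_eval_Delta; apply/mv_add_eq1/h.
  (* Under a valuation giving [Phi] the value 1, everything obtainable has value 1. *)
  apply/consequenceP => v P1; rewrite -lo_eval_Delta; apply/IOneP.
  apply: MP_obtainable_sound h => s [->|]; first exact/IOneP.
  exact.
- rewrite consequence_dominated; split=> -[k [k0 h]]; exists k; split=> //.
    apply/tautologyP => v; rewrite chain_nseq_add // lo_eval_neg // lo_eval_Delta.
    exact/mv_add_eq1/h.
  move=> v; have /tautologyP/(_ v) := h.
  by rewrite chain_nseq_add // lo_eval_neg // lo_eval_Delta => /mv_add_eq1.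
- have E k (v : 'I_n -> itv01 R) : (0 < k)%N ->
      lo (eval v (TImp (chain (@TMul n) TOne (nseq k (Phi theta))) (TDelta psi))) = 1
      <-> 1 - lo (eval v psi) <= k%:R * (1 - lo (eval v (Phi theta))).
    move=> k0; rewrite lo_eval_add lo_eval_neg; last first.
      apply: chain_mul_thin => t; elim: (k) => //= j IH [<-//|]; exact: IH.
    rewrite lo_eval_Delta mv_add_eq1 chain_nseq_mul //.
    have /andP[? ?] := lo_eval_bounds v psi.
    (* If the power is truncated to 0, both sides hold, since the distance of [psi] to 1 is at most
       1. *)
    by set u := k%:R * _; case: (leP 0 (1 - u)) => h; split; lra.
  rewrite consequence_dominated; split=> -[k [k0 h]]; exists k; split=> //.
    by apply/tautologyP => v; apply/E.
  by move=> v; apply/E => //; move/tautologyP: h; apply.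
Qed.
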